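(* Consider the explicit fully discrete scheme $$C_j^{(k),n+1}=C_j^{(k),n}+\frac{\Delta t}{A_j\Delta z}\Bigl(-\bigl(\Phi^{\boldsymbol C,(k),n}_{j+1/2}-\Phi^{\boldsymbol C,(k),n}_{j-1/2}\bigr)+\delta_{j,j_{\mathrm f}}C_{\mathrm f}^{(k),n}Q_{\mathrm f}^n+\gamma_jA_j\Delta z\,R_{\boldsymbol C}^{(k)}(\boldsymbol C_j^n,\boldsymbol S_j^n)\Bigr),\quad k=1,\dots,k_{\boldsymbol C},$$ $$S_j^{(k),n+1}=S_j^{(k),n}+\frac{\Delta t}{A_j\Delta z}\Bigl(-\bigl(\Phi^{\boldsymbol S,(k),n}_{j+1/2}-\Phi^{\boldsymbol S,(k),n}_{j-1/2}\bigr)+\delta_{j,j_{\mathrm f}}S_{\mathrm f}^{(k),n}Q_{\mathrm f}^n+\gamma_jA_j\Delta z\,R_{\boldsymbol S}^{(k)}(\boldsymbol C_j^n,\boldsymbol S_j^n)\Bigr),\quad k=1,\dots,k_{\boldsymbol S},$$ $j=0,\dots,N+1$, with all data, numerical fluxes, constants $\beta_1,\beta_2$ and the set $\Omega$ as defined in the context. If $\boldsymbol U_j^n:=(\boldsymbol C_j^n,\boldsymbol S_j^n,W_j^n)\in\Omega$ for all $j$ and the CFL condition $\Delta t\,\max\{\beta_1,\beta_2\}\le 1$ holds, then $\boldsymbol U_j^{n+1}=(\boldsymbol C_j^{n+1},\boldsymbol S_j^{n+1},W_j^{n+1})\in\Omega$ for all $j$.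
   Context: **Data.** $k_{\boldsymbol C},k_{\boldsymbol S}\ge1$ are integers; $\boldsymbol C=(C^{(1)},\dots,C^{(k_{\boldsymbol C})})$ are solid concentrations, $\boldsymbol S=(S^{(1)},\dots,S^{(k_{\boldsymbol S})})$ soluble concentrations, $X:=C^{(1)}+\dots+C^{(k_{\boldsymbol C})}$. Constants: densities $\rho_X>\rho_L>0$, $r:=\rho_L/\rho_X$, $\Delta\rho:=\rho_X-\rho_L$, gravity $g>0$, maximal solids concentration $X_{\max}$ with $0<X_{\max}<\rho_X$, critical concentration $X_{\mathrm c}\in(0,X_{\max})$, tank dimensions $H,B>0$, diffusion coefficients $d^{(k)}>0$ ($k=1,\dots,k_{\boldsymbol S}$). The water concentration is $W:=\rho_L-rX-(S^{(1)}+\dots+S^{(k_{\boldsymbol S})})$. The cross-sectional area is $A(z)>0$, with $A_{\min}:=\inf_zA(z)>0$. Given functions of time: volumetric flows $Q_{\mathrm f}(t)\ge Q_{\mathrm u}(t)>0$ (feed and underflow), feed concentrations $\boldsymbol C_{\mathrm f}(t)\ge\boldsymbol 0$, $\boldsymbol S_{\mathrm f}(t)\ge\boldsymbol 0$ with $X_{\mathrm f}:=\sum_kC_{\mathrm f}^{(k)}\le X_{\max}$. **Constitutive functions.** $v_{\mathrm{hs}}$ is decreasing on $[0,X_{\max}]$ with $v_{\mathrm{hs}}(X_{\max})=0$; $\sigma_{\mathrm e}'(X)=0$ for $X\le X_{\mathrm c}$ and $\sigma_{\mathrm e}'(X)>0$ for $X>X_{\mathrm c}$; $$d_{\boldsymbol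 C}(X):=\frac{v_{\mathrm{hs}}(X)\rho_X\sigma_{\mathrm e}'(X)}{Xg\Delta\rho},\qquad D_{\boldsymbol C}(X):=\int_{X_{\mathrm c}}^Xd_{\boldsymbol C}(s)\,ds .$$ **Reaction terms.** $\boldsymbol R_{\boldsymbol C}(\boldsymbol C,\boldsymbol S)\in\mathbb R^{k_{\boldsymbol C}}$, $\boldsymbol R_{\boldsymbol S}(\boldsymbol C,\boldsymbol S)\in\mathbb R^{k_{\boldsymbol S}}$ satisfy $\boldsymbol R_{\boldsymbol C}(\boldsymbol 0,\boldsymbol S)=\boldsymbol 0$; $\boldsymbol R_{\boldsymbol S}(\boldsymbol C,\boldsymbol 0)\ge\boldsymbol 0$; $R^{(k)}_{\boldsymbol C}(\boldsymbol C,\boldsymbol S)\ge0$ whenever $C^{(k)}=0$; and $\boldsymbol R_{\boldsymbol C}(\boldsymbol C,\boldsymbol S)=\boldsymbol 0$ whenever $X=X_{\max}$. Put $\tilde R_{\boldsymbol C}:=\sum_kR_{\boldsymbol C}^{(k)}$. All functions are regular enough that the constants below are defined and finite. **Grid.** $\Delta z=(B+H)/N$, $z_{j+1/2}=-H+j\Delta z$, $z_j=-H+(j-\tfrac12)\Delta z$; cell $j$ is $[z_{j-1/2},z_{j+1/2}]$, $j=0,\dots,N+1$; $j_{\mathrm f}:=\lceil H/\Delta z\rceil$; $\delta_{j,j_{\mathrm f}}$ is the Kronecker delta. $\gamma(z)=1$ if $-H<z<B$ and $0$ otherwise; $\gamma_j:=\gamma(z_j)$, $\gamma_{j+1/2}:=\gamma(z_{j+1/2})$.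 $A_j:=\frac1{\Delta z}\int_{z_{j-1/2}}^{z_{j+1/2}}A$, $A_{j+1/2}:=\frac1{\Delta z}\int_{z_j}^{z_{j+1}}A$. The outer values for $j=-1$ and $j=N+2$ are set to zero. $\Delta t>0$ is the time step, $Q_{\mathrm f}^n:=\frac1{\Delta t}\int_{t_n}^{t_{n+1}}Q_{\mathrm f}\,dt$, and similarly for $Q_{\mathrm u}^n,\boldsymbol C_{\mathrm f}^n,\boldsymbol S_{\mathrm f}^n$. $X_j^n:=\sum_kC_j^{(k),n}$, $W_j^n:=\rho_L-rX_j^n-\sum_kS_j^{(k),n}$. Set $A_{j+1/2}q_{j+1/2}^n:=Q_{\mathrm u}^n-Q_{\mathrm f}^n$ if $j<j_{\mathrm f}$ and $:=Q_{\mathrm u}^n$ if $j\ge j_{\mathrm f}$. **Numerical fluxes** (with $a^-:=\min\{a,0\}$, $a^+:=\max\{a,0\}$; all quantities at time $t_n$): $$J^{\boldsymbol C}_{j+1/2}:=\frac{D_{\boldsymbol C}(X_{j+1})-D_{\boldsymbol C}(X_j)}{\Delta z},\qquad v^X_{j+1/2}:=q_{j+1/2}+\gamma_{j+1/2}\bigl(v_{\mathrm{hs}}(X_{j+1})-J^{\boldsymbol C}_{j+1/2}\bigr),$$ $$F^X_{j+1/2}:=(v^{X}_{j+1/2})^-X_{j+1}+(v^{X}_{j+1/2})^+X_j,$$ $$\Phi^{\boldsymbol C,(k)}_{j+1/2}:=A_{j+1/2}\bigl((v^X_{j+1/2})^-C^{(k)}_{j+1}+(v^X_{j+1/2})^+C^{(k)}_j\bigr),$$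 $$\Phi^{\boldsymbol S,(k)}_{j+1/2}:=A_{j+1/2}\Bigl(\frac{(\rho_Xq_{j+1/2}-F^X_{j+1/2})^-S^{(k)}_{j+1}}{\rho_X-X_{j+1}}+\frac{(\rho_Xq_{j+1/2}-F^X_{j+1/2})^+S^{(k)}_j}{\rho_X-X_j}-\gamma_{j+1/2}d^{(k)}\frac{S^{(k)}_{j+1}-S^{(k)}_j}{\Delta z}\Bigr).$$ **Set $\Omega$.** $\Omega$ is the set of $(\boldsymbol C,\boldsymbol S,W)\in\mathbb R^{k_{\boldsymbol C}+k_{\boldsymbol S}+1}$ with $0\le C^{(k)}\le X_{\max}$ for all $k$, $0\le C^{(1)}+\dots+C^{(k_{\boldsymbol C})}\le X_{\max}$, and $S^{(k)}\ge0$ for all $k$. **CFL constants.** $\|\xi\|_\infty:=\max_{0\le X\le X_{\max}}|\xi(X)|$ for $\xi=v_{\mathrm{hs}},v_{\mathrm{hs}}',d_{\boldsymbol C}$; $\|Q_{\mathrm f}\|_{\infty,T}$ is the maximum of $Q_{\mathrm f}$ over the simulated time interval; $\tilde d:=\max_kd^{(k)}$; $$M_{\boldsymbol C}:=\sup_{\Omega,\,k}\Bigl|\frac{\partial R^{(k)}_{\boldsymbol C}}{\partial C^{(k)}}\Bigr|,\quad \tilde M_{\boldsymbol C}:=\sup_{\Omega,\,k}\Bigl|\frac{\partial\tilde R_{\boldsymbol C}}{\partial C^{(k)}}\Bigr|,\quad M_{\boldsymbol S}:=\sup_{\Omega,\,k}\Bigl|\frac{\partial R^{(k)}_{\boldsymbol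 S}}{\partial S^{(k)}}\Bigr|,$$ $$M_1:=\max_{1\le j\le N}\max\Bigl\{\frac{A_{j+1/2}}{A_j},\frac{A_{j-1/2}}{A_j}\Bigr\},\quad M_2:=\max_{1\le j\le N}\frac{A_{j+1/2}+A_{j-1/2}}{A_j},$$ $$\beta_1:=\frac{\|Q_{\mathrm f}\|_{\infty,T}}{A_{\min}\Delta z}+\frac{M_1}{\Delta z}\bigl(\|v_{\mathrm{hs}}'\|_\infty X_{\max}+v_{\mathrm{hs}}(0)\bigr)+\frac{M_2}{\Delta z^2}\bigl(\|d_{\boldsymbol C}\|_\infty X_{\max}+D_{\boldsymbol C}(X_{\max})\bigr)+\max\{M_{\boldsymbol C},\tilde M_{\boldsymbol C}\},$$ $$\beta_2:=\frac{\rho_X+X_{\max}}{\rho_X-X_{\max}}\frac{\|Q_{\mathrm f}\|_{\infty,T}}{A_{\min}\Delta z}+\frac{X_{\max}M_1}{\rho_X-X_{\max}}\frac{\|v_{\mathrm{hs}}\|_\infty}{\Delta z}+\frac{X_{\max}M_2}{\rho_X-X_{\max}}\frac{D_{\boldsymbol C}(X_{\max})}{\Delta z^2}+\tilde d\frac{M_2}{\Delta z^2}+M_{\boldsymbol S}.$$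
   Formalization: Adds the assumption that R_S^(k)(C,S) ≥ 0 on Ω whenever S^(k) = 0, replacing the too weak R_S(C,0) ≥ 0; without it the claim fails for k_S ≥ 2, e.g. R_S = (−S^(2), 0), where M_S = 0 but S^(1) becomes negative. *)

(* Defs.v *)
From HB Require Import structures.
From mathcomp Require Import all_boot all_order all_algebra.
From mathcomp Require Import all_classical all_reals all_analysis.

Set Implicit Arguments.
Unset Strict Implicit.
Unset Printing Implicit Defensive.

Import Order.TTheory GRing.Theory Num.Theory.
Import numFieldNormedType.Exports.

Local Open Scope classical_set_scope.
Local Open Scope ring_scope.

(* The tank is -tankH < z < tankB. *)
Record model (R : realType) (kC kS : nat) := Model {
  rhoX : R;
  rhoL : R;
  grav : R;
  Xmax : R;
  Xc : R;
  tankH : R;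
  tankB : R;
  diffS : 'I_kS -> R;
  area : R -> R;
  Qf : R -> R;
  Qu : R -> R;
  Cf : R -> 'rV[R]_kC;
  Sf : R -> 'rV[R]_kS;
  vhs : R -> R;
  sigmae : R -> R;
  (* The derivative of sigmae.  It is a separate field because sigmae may have a
     kink at Xc (e.g. sigmae X = alpha * max(0, X - Xc)), where the convention
     is dsigmae Xc = 0; see adm_sigmae below. *)
  dsigmae : R -> R;
  RC : 'rV[R]_kC -> 'rV[R]_kS -> 'rV[R]_kC;
  RS : 'rV[R]_kC -> 'rV[R]_kS -> 'rV[R]_kS
}.

Definition vsum {R : realType} {k : nat} (c : 'rV[R]_k) : R := \sum_(i < k) c 0 i.

(* Meaningful for f bounded on [0, M]. *)
Definition sup_norm {R : realType} (M : R) (f : R -> R) : R :=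
  sup [set `|f x| | x in `[0, M]].

Definition mean {R : realType} (a b : R) (f : R -> R) : R :=
  (b - a)^-1 * \int[lebesgue_measure]_(x in `[a, b]) f x.

(* int_a^b f, with the usual sign when b < a. *)
Definition oriented_integral {R : realType} (a b : R) (f : R -> R) : R :=
  if a <= b then \int[lebesgue_measure]_(x in `[a, b]) f x
  else - \int[lebesgue_measure]_(x in `[b, a]) f x.

Section Model.
Context {R : realType} {kC kS : nat}.
Variable m : model R kC kS.

Definition rratio : R := rhoL m / rhoX m.

Definition water (c : 'rV[R]_kC) (s : 'rV[R]_kS) : R :=
  rhoL m - rratio * vsum c - vsum s.

(* At X = 0 the division by 0 is harmless: dsigmae vanishes below Xc. *)
Definition dC (X : R) : R :=
  vhs m X * rhoX m * dsigmae m X / (X * grav m * (rhoX m - rhoL m)).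

Definition DC (X : R) : R := oriented_integral (Xc m) X dC.

Definition Omega : set ('rV[R]_kC * 'rV[R]_kS * R) :=
  [set U : 'rV[R]_kC * 'rV[R]_kS * R |
    [/\ forall k, 0 <= U.1.1 0 k <= Xmax m,
        0 <= vsum U.1.1 <= Xmax m &
        forall k, 0 <= U.1.2 0 k]].

Definition state (c : 'rV[R]_kC) (s : 'rV[R]_kS) : 'rV[R]_kC * 'rV[R]_kS * R :=
  (c, s, water c s).

(* delta_mx 0 k is the k-th unit row vector. *)
Definition abs_dRC : set R :=
  [set x | exists (U : 'rV[R]_kC * 'rV[R]_kS * R) k, Omega U /\
     x = `|'D_(delta_mx 0 k) (fun c : 'rV[R]_kC => RC m c U.1.2 0 k) U.1.1|].

Definition abs_dRCtot : set R :=
  [set x | exists (U : 'rV[R]_kC * 'rV[R]_kS * R) k, Omega U /\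
     x = `|'D_(delta_mx 0 k) (fun c : 'rV[R]_kC => vsum (RC m c U.1.2)) U.1.1|].

Definition abs_dRS : set R :=
  [set x | exists (U : 'rV[R]_kC * 'rV[R]_kS * R) k, Omega U /\
     x = `|'D_(delta_mx 0 k) (fun s : 'rV[R]_kS => RS m U.1.1 s 0 k) U.1.2|].

Definition MC : R := sup abs_dRC.
Definition MCtot : R := sup abs_dRCtot.
Definition MS : R := sup abs_dRS.

Definition Amin : R := inf (range (area m)).

(* Standing assumptions; [0, T] is the simulated time interval.  The
   constitutive and reaction functions are constrained only on [0, Xmax] and on
   Omega. *)
Record admissible (T : R) : Prop := Admissible {
  adm_density : 0 < rhoL m < rhoX m;
  adm_grav : 0 < grav m;
  adm_Xmax : 0 < Xmax m < rhoX m;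
  adm_Xc : 0 < Xc m < Xmax m;
  adm_H : 0 < tankH m;
  adm_B : 0 < tankB m;
  adm_diffS : forall k, 0 < diffS m k;
  adm_area : forall z : R, 0 < area m z;
  adm_Amin : 0 < Amin;
  adm_area_int : forall a b : R,
    lebesgue_measure.-integrable `[a, b] (EFin \o area m);
  adm_flow : forall t : R, 0 <= t <= T -> 0 < Qu m t <= Qf m t;
  adm_Cf : forall t : R, 0 <= t <= T -> forall k, 0 <= Cf m t 0 k;
  adm_Xf : forall t : R, 0 <= t <= T -> vsum (Cf m t) <= Xmax m;
  adm_Sf : forall t : R, 0 <= t <= T -> forall k, 0 <= Sf m t 0 k;
  adm_Qf_bound : has_ubound (Qf m @` `[0, T]);
  adm_Qf_int : lebesgue_measure.-integrable `[0, T] (EFin \o Qf m);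
  adm_Qu_int : lebesgue_measure.-integrable `[0, T] (EFin \o Qu m);
  adm_Cf_int : forall k,
    lebesgue_measure.-integrable `[0, T] (EFin \o (fun t => Cf m t 0 k));
  adm_Sf_int : forall k,
    lebesgue_measure.-integrable `[0, T] (EFin \o (fun t => Sf m t 0 k));
  adm_vhs_dec : forall x y : R, 0 <= x -> x <= y -> y <= Xmax m ->
    vhs m y <= vhs m x;
  adm_vhs_Xmax : vhs m (Xmax m) = 0;
  adm_vhs_derivable : forall X : R, 0 <= X <= Xmax m -> derivable (vhs m) X 1;
  adm_dvhs_bound :
    has_ubound [set `|(vhs m)^`()%classic X| | X in `[0, Xmax m]];
  adm_sigmae : forall X : R, 0 <= X <= Xmax m -> X != Xc m ->
    is_derive X 1 (sigmae m) (dsigmae m X);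
  adm_dsigmae0 : forall X : R, 0 <= X <= Xc m -> dsigmae m X = 0;
  adm_dsigmae_gt0 : forall X : R, Xc m < X <= Xmax m -> 0 < dsigmae m X;
  adm_dC_bound : has_ubound [set `|dC X| | X in `[0, Xmax m]];
  adm_dC_int : lebesgue_measure.-integrable `[0, Xmax m] (EFin \o dC);
  adm_RC0 : forall s W, Omega (0, s, W) -> RC m 0 s = 0;
  adm_RS0 : forall c W, Omega (c, 0, W) -> forall k, 0 <= RS m c 0 0 k;
  adm_RC_ge0 : forall c s W k, Omega (c, s, W) -> c 0 k = 0 ->
    0 <= RC m c s 0 k;
  adm_RC_Xmax : forall c s W, Omega (c, s, W) -> vsum c = Xmax m ->
    RC m c s = 0;
  adm_RC_derivable : forall c s W k, Omega (c, s, W) ->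
    derivable (fun c' : 'rV[R]_kC => RC m c' s 0 k) c (delta_mx 0 k);
  adm_RCtot_derivable : forall c s W k, Omega (c, s, W) ->
    derivable (fun c' : 'rV[R]_kC => vsum (RC m c' s)) c (delta_mx 0 k);
  adm_RS_derivable : forall c s W k, Omega (c, s, W) ->
    derivable (fun s' : 'rV[R]_kS => RS m c s' 0 k) s (delta_mx 0 k);
  adm_dRC_bound : has_ubound abs_dRC;
  adm_dRCtot_bound : has_ubound abs_dRCtot;
  adm_dRS_bound : has_ubound abs_dRS
}.

(* A soluble component that is absent is not consumed.  For kS = 1 this is
   adm_RS0; for kS >= 2 adm_RS0, which sets all soluble components to 0 at once,
   does not imply it: RS = (- S2, 0) satisfies adm_RS0 with MS = 0, but drives
   S1 below 0. *)
Definition RS_ge0 : Prop := forall c s W k, Omega (c, s, W) -> s 0 k = 0 ->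
  0 <= RS m c s 0 k.

Section Grid.
Variable N : nat.

Definition dz : R := (tankB m + tankH m) / N%:R.

(* Cell j is [zhalf (j - 1), zhalf j]: a subscript j + 1/2 is represented by the
   integer j, here and in every name ending in "half". *)
Definition zhalf (j : int) : R := - tankH m + j%:~R * dz.
Definition zcell (j : int) : R := - tankH m + (j%:~R - 2^-1) * dz.

Definition jf : int := Num.ceil (tankH m / dz).

Definition gamma (z : R) : R := if - tankH m < z < tankB m then 1 else 0.

Definition Acell (j : int) : R :=
  dz^-1 * \int[lebesgue_measure]_(z in `[zhalf (j - 1), zhalf j]) area m z.
Definition Ahalf (j : int) : R :=
  dz^-1 * \int[lebesgue_measure]_(z in `[zcell j, zcell (j + 1)]) area m z.

Definition in_grid (j : int) : bool := 0 <= j <= N.+1%:Z.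

Section Step.
Variables (dt : R) (n : nat).

Definition tmean (f : R -> R) : R := mean (n%:R * dt) (n.+1%:R * dt) f.

Definition Qfn : R := tmean (Qf m).
Definition Qun : R := tmean (Qu m).
Definition Cfn (k : 'I_kC) : R := tmean (fun t => Cf m t 0 k).
Definition Sfn (k : 'I_kS) : R := tmean (fun t => Sf m t 0 k).

Definition qhalf (j : int) : R :=
  (if j < jf then Qun - Qfn else Qun) / Ahalf j.

Section Fluxes.
(* One time level. *)
Variables (c : int -> 'rV[R]_kC) (s : int -> 'rV[R]_kS).

Let X (j : int) : R := vsum (c j).

Definition Jhalf (j : int) : R := (DC (X (j + 1)) - DC (X j)) / dz.

Definition vXhalf (j : int) : R :=
  qhalf j + gamma (zhalf j) * (vhs m (X (j + 1)) - Jhalf j).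

Definition FXhalf (j : int) : R :=
  Num.min (vXhalf j) 0 * X (j + 1) + Num.max (vXhalf j) 0 * X j.

Definition PhiC (k : 'I_kC) (j : int) : R :=
  Ahalf j * (Num.min (vXhalf j) 0 * c (j + 1) 0 k
             + Num.max (vXhalf j) 0 * c j 0 k).

Definition PhiS (k : 'I_kS) (j : int) : R :=
  let a := rhoX m * qhalf j - FXhalf j in
  Ahalf j * (Num.min a 0 * s (j + 1) 0 k / (rhoX m - X (j + 1))
             + Num.max a 0 * s j 0 k / (rhoX m - X j)
             - gamma (zhalf j) * diffS m k * ((s (j + 1) 0 k - s j 0 k) / dz)).

Definition nextC (j : int) (k : 'I_kC) : R :=
  c j 0 k + dt / (Acell j * dz) *
    (- (PhiC k j - PhiC k (j - 1)) + (j == jf)%:R * Cfn k * Qfn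
     + gamma (zcell j) * Acell j * dz * RC m (c j) (s j) 0 k).

Definition nextS (j : int) (k : 'I_kS) : R :=
  s j 0 k + dt / (Acell j * dz) *
    (- (PhiS k j - PhiS k (j - 1)) + (j == jf)%:R * Sfn k * Qfn
     + gamma (zcell j) * Acell j * dz * RS m (c j) (s j) 0 k).

Definition zero_outer : Prop :=
  [/\ c (- 1) = 0, c N.+2%:Z = 0, s (- 1) = 0 & s N.+2%:Z = 0].

End Fluxes.
End Step.

(* The step from t_n = n dt to t_(n+1); the first argument of C and S is the
   time level, the second one the cell. *)
Definition scheme_step (dt : R) (n : nat)
    (C : nat -> int -> 'rV[R]_kC) (S : nat -> int -> 'rV[R]_kS) : Prop :=
  forall j, in_grid j ->
    (forall k, C n.+1 j 0 k = nextC dt n (C n) (S n) j k) /\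
    (forall k, S n.+1 j 0 k = nextS dt n (C n) (S n) j k).

(* The operands of the maxima below are positive, so 0 is neutral. *)
Definition M1 : R := \big[Num.max/0]_(1 <= j < N.+1)
  Num.max (Ahalf j%:Z / Acell j%:Z) (Ahalf (j%:Z - 1) / Acell j%:Z).
Definition M2 : R := \big[Num.max/0]_(1 <= j < N.+1)
  ((Ahalf j%:Z + Ahalf (j%:Z - 1)) / Acell j%:Z).
Definition dmax : R := \big[Num.max/0]_(k < kS) diffS m k.

Definition Qfmax (T : R) : R := sup (Qf m @` `[0, T]).

Definition beta1 (T : R) : R :=
  Qfmax T / (Amin * dz)
  + M1 / dz * (sup_norm (Xmax m) ((vhs m)^`()%classic) * Xmax m + vhs m 0)
  + M2 / dz ^+ 2 * (sup_norm (Xmax m) dC * Xmax m + DC (Xmax m))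
  + Num.max MC MCtot.

Definition beta2 (T : R) : R :=
  (rhoX m + Xmax m) / (rhoX m - Xmax m) * (Qfmax T / (Amin * dz))
  + Xmax m * M1 / (rhoX m - Xmax m) * (sup_norm (Xmax m) (vhs m) / dz)
  + Xmax m * M2 / (rhoX m - Xmax m) * (DC (Xmax m) / dz ^+ 2)
  + dmax * (M2 / dz ^+ 2)
  + MS.

End Grid.
End Model.

(* Main.v *)
Require Import Defs.
From HB Require Import structures.
From mathcomp Require Import all_boot all_order all_algebra.
From mathcomp Require Import all_classical all_reals all_analysis.
From mathcomp Require Import ring lra zify.

Set Implicit Arguments.
Unset Strict Implicit.
Unset Printing Implicit Defensive.

Import Order.TTheory GRing.Theory Num.Theory.
Import numFieldNormedType.Exports.

Local Open Scope classical_set_scope.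
Local Open Scope ring_scope.

(* Each unknown is updated by an explicit upwind step, which stays nonnegative
   as soon as the time step times the outflow rate of the cell, plus the rate at
   which the sources can consume the unknown, is at most 1; the CFL constants
   bound exactly these rates.  This applies to the three families of unknowns:
   - to each C^(k), with the flows A v^X;
   - to Xmax - X, with the same flows: its extra source Xmax * div(A v^X) is
     controlled because v_hs(Xmax) = 0 and v_hs, D_C are Lipschitz, and the
     reactions because they vanish at X = Xmax;
   - to each S^(k), with the flows A (rhoX q - F^X) acting on S / (rhoX - X).
   Reactions are compared with their value on the face of Omega where the
   unknown vanishes by the mean value theorem along a coordinate direction. *)

(** * Increments along a line; integrals and means over segments *)

Section Analysis.
Context {R : realType}.
Local Notation mu := (@lebesgue_measure R).

(** Mean value theorem for the scalar function [g t = f (x + t *: v)]: its difference quotients at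
    [t] are those of [f] at [x + t *: v] in the direction [v], so its derivative is the directional
    derivative of [f]. *)
Lemma line_increment_le (V : normedModType R) (f : V -> R) (x v : V) (h M : R) :
  0 <= h ->
  (forall t, 0 <= t <= h -> derivable f (x + t *: v) v) ->
  (forall t, 0 <= t <= h -> `|'D_v f (x + t *: v)| <= M) ->
  `|f (x + h *: v) - f x| <= M * h.
Proof.
move=> h0 df dfM; pose g t := f (x + t *: v).
have gE t : (fun k : R => k^-1 *: (g (k *: 1 + t) - g t)) =
            (fun k : R => k^-1 *: (f (k *: v + (x + t *: v)) - f (x + t *: v))).
  apply/funext => k; rewrite /g (_ : k *: 1 = k); last exact: mulr1.
  by rewrite scalerDl addrCA.
have dg t : 0 <= t <= h -> is_derive t 1 g ('D_v f (x + t *: v)).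
  move=> /df dft; apply: DeriveDef; first by rewrite /derivable gE.
  by rewrite /derive gE.
have [||t] := @MVT_segment R g (fun t => 'D_v f (x + t *: v)) 0 h h0.
- by move=> t /[!in_itv]/= /andP[t0 th]; apply: dg; rewrite !ltW.
- by apply: derivable_within_continuous => t /[!in_itv]/= /dg[].
rewrite in_itv/= subr0 /g scale0r addr0 => /dfM DM ->.
by rewrite normrM (ger0_norm h0) ler_wpM2r.
Qed.

Lemma integrable_cst_itv (a b c : R) : mu.-integrable `[a, b] (EFin \o cst c).
Proof.
apply: continuous_compact_integrable; first exact: segment_compact.
by apply: continuous_subspaceT => x; exact: cvg_cst.
Qed.

Lemma integral_cst_itv (a b c : R) : a <= b ->
  (\int[mu]_(x in `[a, b]) c)%R = c * (b - a).
Proof.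
move=> ab; rewrite Rintegral_cst//= lebesgue_measure_itv/= lte_fin.
case: ltgtP ab => // -> _; by rewrite subrr mulr0.
Qed.

Lemma integrable_sub_itv (a b l u : R) (f : R -> R) : l <= a -> b <= u ->
  mu.-integrable `[l, u] (EFin \o f) -> mu.-integrable `[a, b] (EFin \o f).
Proof.
move=> la bu; apply: integrableS => //.
by apply: subset_itv; rewrite bnd_simp.
Qed.

Lemma le_mean (a b : R) (f g : R -> R) : a < b ->
  mu.-integrable `[a, b] (EFin \o f) -> mu.-integrable `[a, b] (EFin \o g) ->
  (forall x, a <= x <= b -> f x <= g x) -> mean a b f <= mean a b g.
Proof.
move=> ab fi gi fg; apply: ler_wpM2l; first by rewrite invr_ge0 subr_ge0 ltW.
apply: le_Rintegral => // x; rewrite /= in_itv/=; apply: fg.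
Qed.

Lemma mean_cst (a b c : R) : a < b -> mean a b (cst c) = c.
Proof.
move=> ab; rewrite /mean integral_cst_itv ?ltW// mulrCA mulVf ?mulr1//.
by rewrite subr_eq0 gt_eqF.
Qed.

Lemma integrable_sum_itv (I : Type) (s : seq I) (a b : R) (f : I -> R -> R) :
  (forall i, mu.-integrable `[a, b] (EFin \o f i)) ->
  mu.-integrable `[a, b] (EFin \o (fun x => \sum_(i <- s) f i x)).
Proof.
move=> fi; rewrite (_ : _ \o _ = fun x => (\sum_(i <- s) (EFin \o f i) x)%E).
  by apply: integrable_sum => // k _; exact: fi.
by apply/funext => x /=; rewrite sumEFin.
Qed.

Lemma mean_sum (I : finType) (a b : R) (f : I -> R -> R) :
  (forall i, mu.-integrable `[a, b] (EFin \o f i)) ->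
  mean a b (fun x => \sum_i f i x) = \sum_i mean a b (f i).
Proof.
move=> fi; rewrite /mean -mulr_sumr; congr (_ * _).
elim: (index_enum I) => [|i s ih].
  under eq_Rintegral do rewrite big_nil.
  by rewrite big_nil Rintegral_cst// mul0r.
rewrite big_cons -ih -RintegralD//.
  by apply: eq_Rintegral => x _; rewrite big_cons.
exact: integrable_sum_itv.
Qed.

Lemma integral_itvB (a b l u : R) (f : R -> R) : l <= a -> a <= b -> b <= u ->
  mu.-integrable `[l, u] (EFin \o f) ->
  (\int[mu]_(x in `[l, b]) f x - \int[mu]_(x in `[l, a]) f x)%R =
  (\int[mu]_(x in `[a, b]) f x)%R.
Proof.
move=> la ab bu fi.
rewrite Rintegral_itvB ?bnd_simp//; last exact: integrable_sub_itv fi.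
rewrite Rintegral_itv_obnd_cbnd//.
apply: integrableS fi => //; apply: subset_itv; by rewrite bnd_simp.
Qed.

(** Both signs of [b - a] give the same difference of integrals started at [l]. Increments of [DC]
    can thus be computed without locating their endpoints relative to [Xc]. *)
Lemma oriented_integralE (a b l u : R) (f : R -> R) :
  l <= a <= u -> l <= b <= u -> mu.-integrable `[l, u] (EFin \o f) ->
  oriented_integral a b f =
  (\int[mu]_(x in `[l, b]) f x - \int[mu]_(x in `[l, a]) f x)%R.
Proof.
move=> /andP[la au] /andP[lb bu] fi; rewrite /oriented_integral.
case: leP => [ab|/ltW ba]; first by rewrite (@integral_itvB _ _ _ u).
by rewrite -(@integral_itvB _ _ l u)// opprB.
Qed.

End Analysis.

(** * Bounds on the constitutive functions over [[0, Xmax]] *)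

Lemma sup_norm_ge (R : realType) (M x : R) (f : R -> R) :
  has_ubound [set `|f x| | x in `[0, M]] -> 0 <= x <= M ->
  `|f x| <= sup_norm M f.
Proof.
by move=> fb xM; apply: ub_le_sup => //; exists x; rewrite //= in_itv.
Qed.

Lemma sup_norm_ge0 (R : realType) (M : R) (f : R -> R) : 0 <= M ->
  has_ubound [set `|f x| | x in `[0, M]] -> 0 <= sup_norm M f.
Proof.
by move=> M0 fb; apply: le_trans (sup_norm_ge fb (x := 0) _); rewrite ?lexx.
Qed.

Section Constitutive.
Context {R : realType} {kC kS : nat} {m : model R kC kS} {T : R}.
Hypothesis hm : admissible m T.

Lemma vhs_ge0 x : 0 <= x <= Xmax m -> 0 <= vhs m x.
Proof.
by move=> /andP[x0 xM]; rewrite -(adm_vhs_Xmax hm); apply: (adm_vhs_dec hm).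
Qed.

Lemma vhs_le0 x : 0 <= x <= Xmax m -> vhs m x <= vhs m 0.
Proof. by move=> /andP[x0 xM]; apply: (adm_vhs_dec hm). Qed.

Lemma vhs0_le_sup_norm : vhs m 0 <= sup_norm (Xmax m) (vhs m).
Proof.
have /andP[/ltW M0 _] := adm_Xmax hm.
apply: le_trans (ler_norm _) _; apply: sup_norm_ge; last by rewrite lexx.
exists (vhs m 0) => _ [x /= /[!in_itv]/= xM <-].
by rewrite ger0_norm ?vhs_ge0 ?vhs_le0.
Qed.

(** The velocity vanishes at [Xmax], so the mean value theorem on [[x, Xmax]] bounds it by the
    distance to saturation. *)
Lemma vhs_le_lipschitz x : 0 <= x <= Xmax m ->
  vhs m x <= sup_norm (Xmax m) ((vhs m)^`()%classic) * (Xmax m - x).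
Proof.
move=> /andP[x0 xM].
have xt t : 0 <= t <= Xmax m - x -> 0 <= x + t *: 1 <= Xmax m.
  by rewrite [t *: _]mulr1; lra.
have := @line_increment_le R R^o (vhs m) x 1 (Xmax m - x)
  (sup_norm (Xmax m) ((vhs m)^`()%classic)).
rewrite [_ *: 1]mulr1 subrKC (adm_vhs_Xmax hm) sub0r normrN.
move=> /(_ _ _ _)/(le_trans (ler_norm _)); apply => [|t /xt|t /xt xM'].
- by rewrite subr_ge0.
- exact: (adm_vhs_derivable hm).
- by rewrite -derive1E; apply: sup_norm_ge xM'; exact: (adm_dvhs_bound hm).
Qed.

Lemma dC_ge0 x : 0 <= x <= Xmax m -> 0 <= dC m x.
Proof.
move=> /andP[x0 xM]; have v0 : 0 <= vhs m x by rewrite vhs_ge0 ?x0.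
have /andP[L0 LX] := adm_density hm.
have g0 := adm_grav hm.
have s0 : 0 <= dsigmae m x.
  case: (leP x (Xc m)) => xc; first by rewrite (adm_dsigmae0 hm) ?x0.
  by rewrite ltW// (adm_dsigmae_gt0 hm) ?xc.
by rewrite /dC divr_ge0// !mulr_ge0// ?ltW//; lra.
Qed.

(** The increment is the integral of [dC] over [[x, y]], and [dC] lies between 0 and its sup
    norm. *)
Lemma DC_increment x y : 0 <= x -> x <= y -> y <= Xmax m ->
  0 <= DC m y - DC m x <= sup_norm (Xmax m) (dC m) * (y - x).
Proof.
move=> x0 xy yM; have dint := adm_dC_int hm.
have /andP[c0 cM] := adm_Xc hm.
rewrite /DC !(@oriented_integralE _ _ _ 0 (Xmax m))//;
  try by apply/andP; split; lra.
rewrite opprB addrA subrK (@integral_itvB _ _ _ _ (Xmax m))//.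
have xyM t : `[x, y]%classic t -> 0 <= t <= Xmax m.
  by rewrite /= in_itv/= => /andP[xt ty]; apply/andP; split; lra.
apply/andP; split; first by apply: Rintegral_ge0 => t /xyM; exact: dC_ge0.
rewrite -integral_cst_itv//; apply: le_Rintegral => //.
- exact: integrable_sub_itv dint.
- exact: integrable_cst_itv.
- move=> t /xyM tM; apply: le_trans (ler_norm _) _.
  by apply: sup_norm_ge tM; exact: (adm_dC_bound hm).
Qed.

(** [DC] is nondecreasing, and [DC 0 = 0] because [dC] vanishes up to [Xc]; hence all its values lie
    in [[0, DC Xmax]]. *)
Lemma DC_sub_le x y : 0 <= x <= Xmax m -> 0 <= y <= Xmax m ->
  DC m x - DC m y <= DC m (Xmax m).
Proof.
move=> /andP[x0 xM] /andP[y0 yM]; have /andP[c0 cM] := adm_Xc hm.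
have /andP[dx _] := DC_increment x0 xM (lexx _).
have /andP[dy _] := DC_increment (lexx 0) y0 yM.
have dc : DC m 0 = 0.
  rewrite /DC /oriented_integral leNgt c0/= (@eq_Rintegral _ _ _ _ _ (cst 0)).
    by rewrite Rintegral_cst//= mul0r oppr0.
  move=> t; rewrite inE/= in_itv/= => tc.
  by rewrite /dC (adm_dsigmae0 hm)// mulr0 mul0r.
lra.
Qed.

Lemma vhs0_ge0 : 0 <= vhs m 0.
Proof. by have /andP[/ltW M0 _] := adm_Xmax hm; rewrite vhs_ge0 ?lexx. Qed.

Lemma DC_Xmax_ge0 : 0 <= DC m (Xmax m).
Proof.
have /andP[/ltW M0 _] := adm_Xmax hm.
by rewrite -[leLHS](subrr (DC m 0)) DC_sub_le ?lexx.
Qed.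

End Constitutive.

(** * Reaction terms compared with their values on the faces of [Omega] *)

Section Reactions.
Context {R : realType} {kC kS : nat} {m : model R kC kS} {T : R}.
Hypothesis hm : admissible m T.
Variables (c : 'rV[R]_kC) (s : 'rV[R]_kS).
Hypothesis Ocs : Omega m (state m c s).

Lemma vsum_line (k : 'I_kC) (x : 'rV[R]_kC) t :
  vsum (x + t *: delta_mx 0 k) = vsum x + t.
Proof.
rewrite /vsum (bigD1 k)//= [in RHS](bigD1 k)//= !mxE !eqxx/= mulr1 addrAC.
congr (_ + _ + _); apply: eq_bigr => i /negbTE ik.
by rewrite !mxE ik andbF mulr0 addr0.
Qed.

(** With nonnegative entries, each entry is at most the sum, so bounding the sum bounds every
    component. *)
Lemma Omega_intro (c' : 'rV[R]_kC) (s' : 'rV[R]_kS) W :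
  (forall k, 0 <= c' 0 k) -> vsum c' <= Xmax m -> (forall k, 0 <= s' 0 k) ->
  Omega m (c', s', W).
Proof.
move=> c0 cM s0; have ck k : c' 0 k <= vsum c'.
  by rewrite /vsum (bigD1 k)//= lerDl sumr_ge0.
split=> //= [k|]; first by rewrite c0 (le_trans (ck k)).
by rewrite cM andbT sumr_ge0.
Qed.

(** [MC] is the supremum of a bounded set of absolute values; the given state and an index of a
    component provide an element of it. *)
Lemma MC_ge0 : (0 < kC)%N -> 0 <= MC m.
Proof.
move=> kC0; apply: le_trans (ub_le_sup (adm_dRC_bound hm) _);
  last by exists (state m c s), (Ordinal kC0).
exact: normr_ge0.
Qed.

Lemma MCtot_ge0 : (0 < kC)%N -> 0 <= MCtot m.
Proof.
move=> kC0; apply: le_trans (ub_le_sup (adm_dRCtot_bound hm) _);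
  last by exists (state m c s), (Ordinal kC0).
exact: normr_ge0.
Qed.

Lemma MS_ge0 : (0 < kS)%N -> 0 <= MS m.
Proof.
move=> kS0; apply: le_trans (ub_le_sup (adm_dRS_bound hm) _);
  last by exists (state m c s), (Ordinal kS0).
exact: normr_ge0.
Qed.

(** Lower the [k]-th entry of [c] to 0, which gives [x]. The segment from [x] to [c] stays in
    [Omega], the reaction is nonnegative at [x], and its slope along the segment is at most [MC] in
    absolute value. *)
Lemma RC_lower (k : 'I_kC) : - MC m * c 0 k <= RC m c s 0 k.
Proof.
have [ck /andP[_ cM] s0] := Ocs; rewrite /= in ck cM s0.
have ck0 i : 0 <= c 0 i by have /andP[] := ck i.
pose x := c + (- c 0 k) *: delta_mx 0 k.
have Ox t : 0 <= t <= c 0 k -> Omega m (x + t *: delta_mx 0 k, s, 0).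
  move=> /andP[t0 tc]; apply: Omega_intro => // [i|].
    rewrite !mxE /=; have [->|_] := eqVneq i k; first by rewrite /=; lra.
    by rewrite !mulr0 !addr0.
  by rewrite !vsum_line; lra.
have := @line_increment_le R _ (fun c' => RC m c' s 0 k) x (delta_mx 0 k)
  (c 0 k) (MC m) (ck0 k).
rewrite -addrA -scalerDl addNr scale0r addr0 => /(_ _ _)/ler_normlP[||+ _].
- by move=> t /Ox; exact: (adm_RC_derivable hm).
- move=> t /Ox Ot; apply: ub_le_sup; first exact: (adm_dRC_bound hm).
  by exists (x + t *: delta_mx 0 k, s, 0), k.
have : 0 <= RC m x s 0 k.
  apply: (adm_RC_ge0 hm (W := 0)); last by rewrite !mxE !eqxx/=; lra.
  by have := Ox 0; rewrite scale0r addr0; apply; rewrite lexx ck0.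
lra.
Qed.

(** Raise a single component until the total reaches [Xmax], where the reactions vanish. Any
    component serves, since [MCtot] bounds the slope in all of these directions. *)
Lemma RCtot_upper : (0 < kC)%N ->
  vsum (RC m c s) <= MCtot m * (Xmax m - vsum c).
Proof.
move=> kC0; pose k := Ordinal kC0.
have [ck /andP[_ cM] s0] := Ocs; rewrite /= in ck cM s0.
have Ox t : 0 <= t <= Xmax m - vsum c -> Omega m (c + t *: delta_mx 0 k, s, 0).
  move=> /andP[t0 tc]; apply: Omega_intro => // [i|].
    by rewrite !mxE addr_ge0 ?mulr_ge0//; case/andP: (ck i).
  by rewrite !vsum_line; lra.
have h0 : 0 <= Xmax m - vsum c by rewrite subr_ge0.
have := @line_increment_le R _ (fun c' => vsum (RC m c' s)) c (delta_mx 0 k)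
  _ (MCtot m) h0.
move=> /(_ _ _)/ler_normlP[||+ _].
- by move=> t /Ox; exact: (adm_RCtot_derivable hm).
- move=> t /Ox Ot; apply: ub_le_sup; first exact: (adm_dRCtot_bound hm).
  by exists (c + t *: delta_mx 0 k, s, 0), k.
rewrite (@adm_RC_Xmax _ _ _ _ _ hm _ _ 0).
- by rewrite {1}/vsum big1 ?opprB ?subr0// => i _; rewrite mxE.
- by apply: Ox; rewrite h0 lexx.
- by rewrite vsum_line subrKC.
Qed.

(** As for the solids, by emptying the [k]-th soluble component only; [RS_ge0] gives the sign at the
    endpoint, where the other components may be positive. *)
Lemma RS_lower (k : 'I_kS) : RS_ge0 m -> - MS m * s 0 k <= RS m c s 0 k.
Proof.
move=> hRS; have [ck /andP[_ cM] s0] := Ocs; rewrite /= in ck cM s0.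
have ck0 i : 0 <= c 0 i by have /andP[] := ck i.
pose x := s + (- s 0 k) *: delta_mx 0 k.
have Ox t : 0 <= t <= s 0 k -> Omega m (c, x + t *: delta_mx 0 k, 0).
  move=> /andP[t0 tc]; apply: Omega_intro => // i.
  rewrite !mxE /=; have [->|_] := eqVneq i k; first by rewrite /=; lra.
  by rewrite !mulr0 !addr0.
have := @line_increment_le R _ (fun s' => RS m c s' 0 k) x (delta_mx 0 k)
  (s 0 k) (MS m) (s0 k).
rewrite -addrA -scalerDl addNr scale0r addr0 => /(_ _ _)/ler_normlP[||+ _].
- by move=> t /Ox; exact: (adm_RS_derivable hm).
- move=> t /Ox Ot; apply: ub_le_sup; first exact: (adm_dRS_bound hm).
  by exists (c, x + t *: delta_mx 0 k, 0), k.
have : 0 <= RS m c x 0 k.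
  apply: (hRS _ _ 0); last by rewrite !mxE !eqxx/=; lra.
  by have := Ox 0; rewrite scale0r addr0; apply; rewrite lexx s0.
lra.
Qed.

End Reactions.

(* Upwind update of x with interface flows wp (right) and wm (left): only the
   outflow removes mass from the cell. *)
Lemma upwind_step_ge0 (R : realDomainType) (x u up um wp wm lam src : R) :
  0 <= lam -> 0 <= up -> 0 <= um ->
  lam * (Num.max wp 0 - Num.min wm 0) * u <= x + lam * src ->
  0 <= x + lam * (- ((Num.min wp 0 * up + Num.max wp 0 * u)
                     - (Num.min wm 0 * u + Num.max wm 0 * um)) + src).
Proof.
move=> lam0 up0 um0 outflow.
have hp : 0 <= lam * - Num.min wp 0 * up.
  by rewrite !mulr_ge0// oppr_ge0 ge_min lexx orbT.
have hm : 0 <= lam * Num.max wm 0 * um.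
  by rewrite !mulr_ge0// le_max lexx orbT.
lra.
Qed.

(** * Grid geometry: interfaces and cross-sectional areas *)

Section Flows.
Context {R : realType} {kC kS : nat} {m : model R kC kS} {T : R}.
Hypothesis hm : admissible m T.
Context {N : nat}.
Hypothesis hN : (0 < N)%N.

Lemma dz_gt0 : 0 < dz m N.
Proof. by rewrite divr_gt0 ?ltr0n// addr_gt0 ?(adm_B hm) ?(adm_H hm). Qed.

Lemma gamma_cases z : gamma m z = 0 \/ gamma m z = 1.
Proof. by rewrite /gamma; case: ifP; [right|left]. Qed.

Lemma gamma_ge0 z : 0 <= gamma m z.
Proof. by case: (gamma_cases z) => ->. Qed.

(** Interfaces 0 and [N] lie exactly at the two ends of the tank, and the inequalities defining
    [gamma] are strict. *)
Lemma gamma_zhalf_eq0 j : ~~ (0 < j < N%:Z) -> gamma m (zhalf m N j) = 0.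
Proof.
move=> jN; rewrite /gamma; case: ifP => // /andP[].
rewrite /zhalf => Hz zB; case/negP: jN; have h0 := dz_gt0.
have j0 : 0 < j%:~R * dz m N by lra.
have jB : j%:~R * dz m N < N%:Z%:~R * dz m N.
  rewrite -pmulrn [ltRHS]mulrC divfK ?pnatr_eq0 -?lt0n//; lra.
by move: j0 jB; rewrite pmulr_lgt0// ltr0z ltr_pM2r// ltr_int => -> ->.
Qed.

Lemma Amin_le_mean a b : a < b -> Amin m <= mean a b (area m).
Proof.
move=> ab; rewrite -(mean_cst (Amin m) ab); apply: le_mean => //.
- exact: integrable_cst_itv.
- exact: (adm_area_int hm).
- move=> x _; apply: ge_inf; last by exists x.
  by exists 0 => _ [z _ <-]; rewrite ltW// (adm_area hm).
Qed.

Lemma Acell_ge_Amin j : Amin m <= Acell m N j.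
Proof.
have -> : Acell m N j = mean (zhalf m N (j - 1)) (zhalf m N j) (area m).
  by rewrite /mean /Acell; congr (_^-1 * _); rewrite /zhalf intrB; ring.
by apply: Amin_le_mean; rewrite /zhalf intrB; have := dz_gt0; lra.
Qed.

Lemma Ahalf_ge_Amin j : Amin m <= Ahalf m N j.
Proof.
have -> : Ahalf m N j = mean (zcell m N j) (zcell m N (j + 1)) (area m).
  by rewrite /mean /Ahalf; congr (_^-1 * _); rewrite /zcell intrD; ring.
by apply: Amin_le_mean; rewrite /zcell intrD; have := dz_gt0; lra.
Qed.

Lemma Acell_gt0 j : 0 < Acell m N j.
Proof. exact: lt_le_trans (adm_Amin hm) (Acell_ge_Amin j). Qed.

Lemma Ahalf_gt0 j : 0 < Ahalf m N j.
Proof. exact: lt_le_trans (adm_Amin hm) (Ahalf_ge_Amin j). Qed.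

(** The area available to settling, compression and diffusion, which act only strictly inside the
    tank. *)
Definition inner_area j := gamma m (zhalf m N j) * Ahalf m N j.

Lemma inner_area_ge0 j : 0 <= inner_area j.
Proof. by rewrite mulr_ge0 ?gamma_ge0// ltW// Ahalf_gt0. Qed.

Lemma inner_area_le_Ahalf j : inner_area j <= Ahalf m N j.
Proof.
by rewrite /inner_area; case: (gamma_cases (zhalf m N j)) => ->;
   rewrite ?mul1r// mul0r ltW// Ahalf_gt0.
Qed.

Lemma M1_ge0 : 0 <= M1 m N.
Proof. exact: bigmax_ge_id. Qed.

Lemma M2_ge0 : 0 <= M2 m N.
Proof. exact: bigmax_ge_id. Qed.

(** [M1] and [M2] are maxima over the cells 1 to [N] only. For any other cell both adjacent inner
    areas vanish, so the bounds extend to all [j]. *)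
Lemma inner_area_le j :
  [/\ inner_area j <= M1 m N * Acell m N j,
      inner_area (j - 1) <= M1 m N * Acell m N j &
      inner_area j + inner_area (j - 1) <= M2 m N * Acell m N j].
Proof.
have A0 := Acell_gt0 j.
have [/andP[j0 jN]|jout] := boolP (0 < j <= N%:Z); last first.
  have -> : inner_area j = 0.
    by rewrite /inner_area gamma_zhalf_eq0 ?mul0r//; lia.
  have -> : inner_area (j - 1) = 0.
    by rewrite /inner_area gamma_zhalf_eq0 ?mul0r//; lia.
  by split; rewrite ?addr0 mulr_ge0 ?M1_ge0 ?M2_ge0 ?ltW.
have [i ji] : exists i : nat, j = i%:Z by exists `|j|%N; lia.
have iN : i \in index_iota 1 N.+1 by rewrite mem_index_iota; lia.
rewrite -!ler_pdivrMr//.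
have := @le_bigmax_seq _ _ _ _ 0 i predT
  (fun i => Num.max (Ahalf m N i%:Z / Acell m N i%:Z)
                    (Ahalf m N (i%:Z - 1) / Acell m N i%:Z)) iN isT.
have := @le_bigmax_seq _ _ _ _ 0 i predT
  (fun i => (Ahalf m N i%:Z + Ahalf m N (i%:Z - 1)) / Acell m N i%:Z) iN isT.
rewrite -ji => h2; rewrite ge_max => /andP[h1 h1'].
split; [apply: le_trans h1|apply: le_trans h1'|apply: le_trans h2];
  by rewrite ler_pM2r ?invr_gt0 ?lerD ?inner_area_le_Ahalf.
Qed.

(** * Time averages of the data over one step *)

Context {dt : R} {n : nat}.
Hypothesis dt_gt0 : 0 < dt.
Hypothesis hT : n.+1%:R * dt <= T.
Local Notation tmean := (tmean dt n).

Lemma step_itv : n%:R * dt < n.+1%:R * dt.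
Proof. by rewrite ltr_pM2r// ltr_nat. Qed.

Lemma step_sub t : n%:R * dt <= t <= n.+1%:R * dt -> 0 <= t <= T.
Proof.
move=> /andP[nt tn]; rewrite (le_trans tn hT) (le_trans _ nt)//.
by rewrite mulr_ge0// ltW.
Qed.

Lemma step_integrable f :
  lebesgue_measure.-integrable `[0, T] (EFin \o f) ->
  lebesgue_measure.-integrable `[n%:R * dt, n.+1%:R * dt] (EFin \o f).
Proof. by apply: integrable_sub_itv => //; rewrite mulr_ge0// ltW. Qed.

Lemma le_tmean f g :
  lebesgue_measure.-integrable `[0, T] (EFin \o f) ->
  lebesgue_measure.-integrable `[0, T] (EFin \o g) ->
  (forall t, 0 <= t <= T -> f t <= g t) -> tmean f <= tmean g.
Proof.
move=> fi gi fg; apply: le_mean step_itv _ _ _; try exact: step_integrable.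
by move=> t /step_sub; exact: fg.
Qed.

Lemma tmean_cst a : tmean (cst a) = a.
Proof. exact: mean_cst step_itv. Qed.

Lemma tmean_ge0 f : lebesgue_measure.-integrable `[0, T] (EFin \o f) ->
  (forall t, 0 <= t <= T -> 0 <= f t) -> 0 <= tmean f.
Proof.
move=> fi f0; rewrite -(tmean_cst 0); apply: le_tmean => //.
exact: integrable_cst_itv.
Qed.

Lemma Cfn_ge0 k : 0 <= Cfn m dt n k.
Proof.
by apply: tmean_ge0 (adm_Cf_int hm k) _ => t tT; exact: (adm_Cf hm).
Qed.

Lemma Sfn_ge0 k : 0 <= Sfn m dt n k.
Proof.
by apply: tmean_ge0 (adm_Sf_int hm k) _ => t tT; exact: (adm_Sf hm).
Qed.

Lemma sum_Cfn_le : \sum_k Cfn m dt n k <= Xmax m.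
Proof.
rewrite -[leRHS]tmean_cst -mean_sum; last first.
  by move=> k; exact/step_integrable/(adm_Cf_int hm).
apply: le_mean step_itv _ _ _.
- by apply: integrable_sum_itv => k; exact/step_integrable/(adm_Cf_int hm).
- exact: integrable_cst_itv.
- by move=> t /step_sub; exact: (adm_Xf hm).
Qed.

Lemma Qun_ge0 : 0 <= Qun m dt n.
Proof.
apply: tmean_ge0 (adm_Qu_int hm) _ => t /(adm_flow hm)/andP[+ _].
exact: ltW.
Qed.

Lemma Qun_le_Qfn : Qun m dt n <= Qfn m dt n.
Proof.
apply: le_tmean (adm_Qu_int hm) (adm_Qf_int hm) _.
by move=> t /(adm_flow hm)/andP[].
Qed.

Lemma Qfn_ge0 : 0 <= Qfn m dt n.
Proof. exact: (le_trans Qun_ge0 Qun_le_Qfn). Qed.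

Lemma feed_ge0 (b : bool) x : 0 <= x -> 0 <= b%:R * x * Qfn m dt n.
Proof. by move=> x0; apply: mulr_ge0 (mulr_ge0 _ x0) Qfn_ge0; apply: ler0n. Qed.

Lemma Qfn_le_Qfmax : Qfn m dt n <= Qfmax m T.
Proof.
rewrite -[leRHS]tmean_cst; apply: le_tmean (adm_Qf_int hm) _ _.
  exact: integrable_cst_itv.
move=> t tT; apply: ub_le_sup; first exact: (adm_Qf_bound hm).
by exists t; rewrite //= in_itv.
Qed.

(** * Bulk flow through the interfaces *)

Definition bulk j := Ahalf m N j * qhalf m N dt n j.

Lemma bulkE j : bulk j =
  if j < jf m N then Qun m dt n - Qfn m dt n else Qun m dt n.
Proof. by rewrite /bulk /qhalf mulrC divfK// gt_eqF// Ahalf_gt0. Qed.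

(** The divergence of the bulk flow is concentrated in the feed cell, where it equals the feed rate.
    This lets the feed be balanced against the bulk flow in the bound on the total solids. *)
Lemma bulk_diff j :
  bulk j - bulk (j - 1) = (j == jf m N)%:R * Qfn m dt n.
Proof.
clear dt_gt0 hT; rewrite !bulkE; have [jl|jg|->] := ltgtP j (jf m N).
- by rewrite (_ : (j - 1 < _) = true) ?subrr ?mul0r//; lia.
- by rewrite (_ : (j - 1 < _) = false) ?subrr ?mul0r//; lia.
- by rewrite (_ : (_ - 1 < _) = true) ?mul1r; [ring|lia].
Qed.

Lemma bulk_le0_or_ge0 j :
  (j < jf m N /\ bulk j = Qun m dt n - Qfn m dt n) \/
  (jf m N <= j /\ bulk j = Qun m dt n).
Proof. by rewrite bulkE; case: ltP; [left|right]. Qed.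

(** The worst case is the feed cell, drained from both sides: [Qu] on the right and [Qf - Qu] on the
    left add up to [Qf]. *)
Lemma bulk_outflow_le j :
  Num.max (bulk j) 0 - Num.min (bulk (j - 1)) 0 <= Qfmax m T.
Proof.
have Qu0 := Qun_ge0; have QuQf := Qun_le_Qfn; have QfM := Qfn_le_Qfmax.
case: (bulk_le0_or_ge0 j) => -[jj ->];
  case: (bulk_le0_or_ge0 (j - 1)) => -[jj' ->]; rewrite /Num.max /Num.min;
  do 2?case: ltP => ?; lra.
Qed.

(** This serves the soluble components: solids entering a cell displace liquid out of it. *)
Lemma bulk_inflow_le j :
  Num.max (bulk (j - 1)) 0 - Num.min (bulk j) 0 <= Qfmax m T.
Proof.
have Qu0 := Qun_ge0; have QuQf := Qun_le_Qfn; have QfM := Qfn_le_Qfmax.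
case: (bulk_le0_or_ge0 j) => -[jj ->];
  case: (bulk_le0_or_ge0 (j - 1)) => -[jj' ->]; rewrite /Num.max /Num.min;
  do 2?case: ltP => ?; try lra; exfalso; lia.
Qed.

End Flows.

(** * One time step in a fixed cell [j]: velocities and flows of the solids *)

Section Invariance.
Context {R : realType} {kC kS : nat} {m : model R kC kS} {T : R}.
Hypothesis hm : admissible m T.
Context {N : nat}.
Hypothesis hN : (0 < N)%N.
Context {dt : R} {n : nat}.
Hypothesis dt_gt0 : 0 < dt.
Hypothesis hT : n.+1%:R * dt <= T.
Context {c : int -> 'rV[R]_kC} {s : int -> 'rV[R]_kS}.
Hypothesis houter : zero_outer N c s.
Hypothesis hOmega : forall j, in_grid N j -> Omega m (state m (c j) (s j)).
Context {j : int}.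
Hypothesis jN : in_grid N j.

Local Notation h := (dz m N).
Local Notation X_ i := (vsum (c i)).
Local Notation lam := (dt / (Acell m N j * h)).
Local Notation area_ i := (@inner_area _ _ _ m N i).
Local Notation bulk_ i := (@bulk _ _ _ m N dt n i).
Local Notation Dmax := (DC m (Xmax m)).

Let h0 : 0 < h := dz_gt0 hm hN.
Let A0 : 0 < Acell m N j := Acell_gt0 hm hN j.
Let Ah0 : 0 < Acell m N j * h := mulr_gt0 A0 h0.

(** The zero outer values also lie in [Omega], so the end cells 0 and [N + 1] need no separate
    treatment. *)
Lemma Omega_outer i : -1 <= i <= N.+2%:Z -> Omega m (state m (c i) (s i)).
Proof.
move=> /andP[i1 i2]; have [c1 c2 s1 s2] := houter.
have /andP[/ltW M0 _] := adm_Xmax hm.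
have O0 : Omega m (state m 0 0).
  apply: Omega_intro => [k||k]; rewrite ?mxE//.
  by rewrite /vsum big1// => k _; rewrite mxE.
have [->|iN1] := eqVneq i (-1); first by rewrite c1 s1.
have [->|iN2] := eqVneq i N.+2%:Z; first by rewrite c2 s2.
by apply: hOmega; rewrite /in_grid; lia.
Qed.

Lemma Omega_near i : j - 1 <= i <= j + 1 -> Omega m (state m (c i) (s i)).
Proof.
by move=> ij; apply: Omega_outer; move: ij jN; rewrite /in_grid; lia.
Qed.

Lemma X_near i : j - 1 <= i <= j + 1 -> 0 <= X_ i <= Xmax m.
Proof. by move=> /Omega_near[]. Qed.

Lemma C_near k i : j - 1 <= i <= j + 1 -> 0 <= c i 0 k.
Proof. by move=> /Omega_near[/(_ k)/andP[]]. Qed.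

Lemma S_near k i : j - 1 <= i <= j + 1 -> 0 <= s i 0 k.
Proof. by move=> /Omega_near[_ _]. Qed.

Let ltj : j - 1 <= j - 1 <= j + 1. Proof. by lia. Qed.
Let mid : j - 1 <= j <= j + 1. Proof. by lia. Qed.
Let rtj : j - 1 <= j + 1 <= j + 1. Proof. by lia. Qed.

(** Velocity of the solids relative to the bulk: settling minus compression. *)
Definition drift i := vhs m (X_ (i + 1)) - Jhalf m N c i.
Definition flow i := Ahalf m N i * vXhalf m N dt n c i.

Lemma flowE i : flow i = bulk_ i + area_ i * drift i.
Proof.
by rewrite /flow /vXhalf mulrDr; congr (_ + _); rewrite mulrCA mulrA.
Qed.

Lemma Ahalf_min i x : Ahalf m N i * Num.min x 0 = Num.min (Ahalf m N i * x) 0.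
Proof. by rewrite minr_pMr ?mulr0// ltW// (Ahalf_gt0 hm hN). Qed.

Lemma Ahalf_max i x : Ahalf m N i * Num.max x 0 = Num.max (Ahalf m N i * x) 0.
Proof. by rewrite maxr_pMr ?mulr0// ltW// (Ahalf_gt0 hm hN). Qed.

Lemma drift_bounds i : 0 <= X_ i <= Xmax m -> 0 <= X_ (i + 1) <= Xmax m ->
  - (Dmax / h) <= drift i <= vhs m 0 + Dmax / h.
Proof.
move=> Xi Xi1; have v0 := vhs_ge0 hm Xi1; have vM := vhs_le0 hm Xi1.
have hi0 : 0 <= h^-1 by rewrite invr_ge0 ltW.
have := ler_wpM2r hi0 (DC_sub_le hm Xi Xi1).
have := ler_wpM2r hi0 (DC_sub_le hm Xi1 Xi); rewrite !mulrBl => d1 d2.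
by rewrite /drift /Jhalf mulrBl; apply/andP; split; lra.
Qed.

Lemma flow_max_le i : 0 <= X_ i <= Xmax m -> 0 <= X_ (i + 1) <= Xmax m ->
  Num.max (flow i) 0 <= Num.max (bulk_ i) 0 + area_ i * (vhs m 0 + Dmax / h).
Proof.
move=> Xi Xi1; have /andP[d1 d2] := drift_bounds Xi Xi1.
have a0 := inner_area_ge0 hm hN i.
have ad := ler_wpM2l a0 d2; have ad0 := ler_wpM2l a0 (le_trans d1 d2).
have v0 : 0 <= vhs m 0 + Dmax / h.
  by rewrite addr_ge0 ?(vhs0_ge0 hm)// divr_ge0 ?(DC_Xmax_ge0 hm)// ltW.
have av := mulr_ge0 a0 v0.
rewrite flowE ge_max; apply/andP; split.
  by apply: lerD ad; rewrite le_max lexx.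
by rewrite addr_ge0// le_max lexx orbT.
Qed.

(** Settling only pushes in the positive direction, so against it only compression contributes. The
    outflow of a cell therefore involves [vhs 0] at one interface, matched by [M1], but compression
    at both, matched by [M2]. *)
Lemma flow_min_le i : 0 <= X_ i <= Xmax m -> 0 <= X_ (i + 1) <= Xmax m ->
  - Num.min (flow i) 0 <= - Num.min (bulk_ i) 0 + area_ i * (Dmax / h).
Proof.
move=> Xi Xi1; have /andP[d1 _] := drift_bounds Xi Xi1.
have a0 := inner_area_ge0 hm hN i.
have ad := ler_wpM2l a0 d1.
have D0 : 0 <= Dmax / h by rewrite divr_ge0 ?(DC_Xmax_ge0 hm)// ltW.
have aD := mulr_ge0 a0 D0.
have b1 : Num.min (bulk_ i) 0 <= bulk_ i by rewrite ge_min lexx.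
have b2 : Num.min (bulk_ i) 0 <= 0 by rewrite ge_min lexx orbT.
rewrite lerNl opprD opprK flowE le_min; apply/andP; split; lra.
Qed.

(** * Rates scaled by the time step: [q1] bulk, [q2] one interface, [q3] both interfaces *)

Local Notation q1 := (dt * (Qfmax m T / (Amin m * h))).
Local Notation q2 := (dt * (M1 m N / h)).
Local Notation q3 := (dt * (M2 m N / h ^+ 2)).

Lemma lam_gt0 : 0 < lam.
Proof. exact: divr_gt0. Qed.

Lemma Qfmax_ge0 : 0 <= Qfmax m T.
Proof.
exact: (le_trans (Qfn_ge0 hm dt_gt0 hT) (Qfn_le_Qfmax hm dt_gt0 hT)).
Qed.

Lemma lam_Qfmax : lam * Qfmax m T <= q1.
Proof.
rewrite -mulrA ler_pM2l// mulrC ler_wpM2l ?Qfmax_ge0//.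
have Mh0 : 0 < Amin m * h := mulr_gt0 (adm_Amin hm) h0.
rewrite lef_pV2 ?posrE//; apply: ler_wpM2r; first exact: ltW.
exact: (Acell_ge_Amin hm hN).
Qed.

Lemma lam_area (x M : R) : x <= M * Acell m N j -> lam * x <= dt * (M / h).
Proof.
move=> xM; rewrite -mulrA ler_pM2l// mulrC ler_pdivrMr//.
by apply: le_trans xM _; rewrite [leRHS](_ : _ = M * Acell m N j)//; field;
   rewrite gt_eqF.
Qed.

Lemma lam_area_r : lam * area_ j <= q2.
Proof. by apply: lam_area; have [] := inner_area_le hm hN j. Qed.

Lemma lam_area_l : lam * area_ (j - 1) <= q2.
Proof. by apply: lam_area; have [] := inner_area_le hm hN j. Qed.

Lemma lam_area_sum : (lam * area_ j + lam * area_ (j - 1)) / h <= q3.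
Proof.
rewrite ler_pdivrMr// -mulrDr.
apply: le_trans (lam_area (M := M2 m N) _) _.
  by have [] := inner_area_le hm hN j.
by rewrite [leLHS](_ : _ = q3 * h)//; field; rewrite gt_eqF.
Qed.

Lemma lam_area_ge0 i : 0 <= lam * area_ i.
Proof. by rewrite mulr_ge0 ?(inner_area_ge0 hm hN)// ltW// lam_gt0. Qed.

Lemma q2_ge0 : 0 <= q2.
Proof. exact: le_trans (lam_area_ge0 _) lam_area_r. Qed.

Lemma q3_ge0 : 0 <= q3.
Proof.
by apply: le_trans lam_area_sum; rewrite divr_ge0 ?addr_ge0 ?lam_area_ge0 ?ltW.
Qed.

Lemma lam_reaction z r :
  lam * (gamma m z * Acell m N j * h * r) = dt * (gamma m z * r).
Proof. by field; rewrite !gt_eqF. Qed.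

Lemma outflow_le :
  lam * (Num.max (flow j) 0 - Num.min (flow (j - 1)) 0) <=
  q1 + q2 * vhs m 0 + q3 * Dmax.
Proof.
have f1 := flow_max_le (X_near mid) (X_near rtj).
have f2 := @flow_min_le (j - 1) (X_near ltj).
rewrite subrK in f2; have {}f2 := f2 (X_near mid).
have b := bulk_outflow_le hm hN dt_gt0 hT j.
have f : Num.max (flow j) 0 - Num.min (flow (j - 1)) 0 <=
  Qfmax m T + area_ j * vhs m 0 + (area_ j + area_ (j - 1)) * (Dmax / h) by lra.
have lf := ler_wpM2l (ltW lam_gt0) f.
have l1 := lam_Qfmax.
have l2 := ler_wpM2r (vhs0_ge0 hm) lam_area_r.
have l3 := ler_wpM2r (DC_Xmax_ge0 hm) lam_area_sum.
lra.
Qed.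

(** * Solid components: nonnegativity and the bound on their sum *)

Hypothesis kC_gt0 : (0 < kC)%N.
Local Notation Lv := (sup_norm (Xmax m) ((vhs m)^`()%classic)).
Local Notation Ld := (sup_norm (Xmax m) (dC m)).

Hypothesis cfl1 : dt * beta1 m N T <= 1.

Lemma cfl1E :
  q1 + q2 * (Lv * Xmax m + vhs m 0) + q3 * (Ld * Xmax m + Dmax)
  + dt * Num.max (MC m) (MCtot m) <= 1.
Proof. by apply: le_trans cfl1; rewrite /beta1 -!mulrA -!mulrDr. Qed.

Lemma PhiCE k i : PhiC m N dt n c k i =
  Num.min (flow i) 0 * c (i + 1) 0 k + Num.max (flow i) 0 * c i 0 k.
Proof. by rewrite /PhiC mulrDr !mulrA Ahalf_min Ahalf_max. Qed.

Lemma nextC_ge0 k : 0 <= nextC m N dt n c s j k.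
Proof.
rewrite /nextC !PhiCE subrK -[X in _ + lam * X]addrA.
have u0 := C_near k mid.
apply: upwind_step_ge0; [exact/ltW/lam_gt0|exact: C_near|exact: C_near|].
rewrite [in leRHS]mulrDr lam_reaction.
have feed : 0 <= lam * ((j == jf m N)%:R * Cfn m dt n k * Qfn m dt n).
  apply: mulr_ge0 (ltW lam_gt0) (feed_ge0 hm dt_gt0 hT _ _).
  exact: (Cfn_ge0 hm dt_gt0 hT).
have react : - (dt * MC m * c j 0 k) <=
             dt * (gamma m (zcell m N j) * RC m (c j) (s j) 0 k).
  rewrite -mulrA -mulrN ler_pM2l//.
  have := RC_lower hm (hOmega jN) k.
  have := mulr_ge0 (MC_ge0 hm (hOmega jN) kC_gt0) u0.
  by case: (gamma_cases (m := m) (zcell m N j)) => ->; lra.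
have out := ler_wpM2r u0 outflow_le.
have maxM : dt * MC m <= dt * Num.max (MC m) (MCtot m).
  by rewrite ler_pM2l// le_max lexx.
have /andP[/ltW M0 _] := adm_Xmax hm.
(* The Lipschitz terms of [beta1] are reserved for the upper bound on the total; being nonnegative,
   they may be discarded here. *)
have e2 := mulr_ge0 q2_ge0
  (mulr_ge0 (sup_norm_ge0 M0 (adm_dvhs_bound hm)) M0).
have e3 := mulr_ge0 q3_ge0 (mulr_ge0 (sup_norm_ge0 M0 (adm_dC_bound hm)) M0).
have cfl : q1 + q2 * vhs m 0 + q3 * Dmax + dt * MC m <= 1.
  by have := cfl1E; lra.
have := ler_wpM2r u0 cfl.
lra.
Qed.

Lemma sum_PhiC i : \sum_k PhiC m N dt n c k i =
  Num.min (flow i) 0 * X_ (i + 1) + Num.max (flow i) 0 * X_ i.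
Proof.
by under eq_bigr do rewrite PhiCE; rewrite big_split /= -!mulr_sumr.
Qed.

Lemma sum_nextC : \sum_k nextC m N dt n c s j k =
  X_ j + lam * (- ((Num.min (flow j) 0 * X_ (j + 1) + Num.max (flow j) 0 * X_ j)
                  - (Num.min (flow (j - 1)) 0 * X_ j
                     + Num.max (flow (j - 1)) 0 * X_ (j - 1)))
               + (j == jf m N)%:R * (\sum_k Cfn m dt n k) * Qfn m dt n
               + gamma m (zcell m N j) * Acell m N j * h
                 * vsum (RC m (c j) (s j))).
Proof.
rewrite /nextC big_split /= -mulr_sumr !big_split /= sumrN sumrB.
rewrite !sum_PhiC subrK.
by rewrite -mulr_suml -!mulr_sumr.
Qed.

(** Backward drift into the cell comes from compression alone. Since [DC] is nondecreasing, it is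
    largest when the right neighbour is full, and it vanishes when cell [j] is full. *)
Lemma drift_r_ge : - (Ld * (Xmax m - X_ j) / h) <= drift j.
Proof.
have /andP[Xj0 XjM] := X_near mid; have /andP[Xr0 XrM] := X_near rtj.
have /andP[_ dj] := DC_increment hm Xj0 XjM (lexx _).
have /andP[dr _] := DC_increment hm Xr0 XrM (lexx _).
have v0 := vhs_ge0 hm (X_near rtj).
have : - (Ld * (Xmax m - X_ j)) <= - (DC m (X_ (j + 1)) - DC m (X_ j)) by lra.
rewrite -(@ler_pM2r _ h^-1) ?invr_gt0// !mulNr /drift /Jhalf => hJ.
by rewrite -[leLHS]add0r; apply: lerD.
Qed.

(** The flux evaluates [vhs] in the receiving cell, so settling into cell [j] also dies out as the
    cell fills up. *)
Lemma drift_l_le :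
  drift (j - 1) <= Lv * (Xmax m - X_ j) + Ld * (Xmax m - X_ j) / h.
Proof.
have /andP[Xj0 XjM] := X_near mid; have /andP[Xl0 XlM] := X_near ltj.
have /andP[_ dj] := DC_increment hm Xj0 XjM (lexx _).
have /andP[dl _] := DC_increment hm Xl0 XlM (lexx _).
have v0 := vhs_le_lipschitz hm (X_near mid).
have : - (DC m (X_ j) - DC m (X_ (j - 1))) <= Ld * (Xmax m - X_ j) by lra.
rewrite -(@ler_pM2r _ h^-1) ?invr_gt0// mulNr => hJ.
by rewrite /drift /Jhalf subrK; apply: lerD.
Qed.

(* The complement Xmax - X is again transported by the upwind scheme; its source
   is Xmax times the divergence of the flow, minus feed and reaction. *)
Lemma sum_nextC_le : \sum_k nextC m N dt n c s j k <= Xmax m.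
Proof.
pose Y i := Xmax m - X_ i.
have Y0 i : j - 1 <= i <= j + 1 -> 0 <= Y i.
  by rewrite subr_ge0 => /X_near/andP[].
set feed := (j == jf m N)%:R * (\sum_k Cfn m dt n k) * Qfn m dt n.
set react := gamma m (zcell m N j) * Acell m N j * h * vsum (RC m (c j) (s j)).
pose src := Xmax m * (flow j - flow (j - 1)) - feed - react.
rewrite -subr_ge0 [leRHS](_ : _ = Y j + lam * (-
    ((Num.min (flow j) 0 * Y (j + 1) + Num.max (flow j) 0 * Y j)
     - (Num.min (flow (j - 1)) 0 * Y j + Num.max (flow (j - 1)) 0 * Y (j - 1)))
    + src)); last first.
  (* The upwind flux of the constant [Xmax] is [Xmax] times the flow, since a flow is the sum of its
     negative and positive parts; subtracting the flux of [X] gives that of [Y]. *)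
  rewrite sum_nextC -/feed -/react /src.
  have split_flow i : flow i = Num.min (flow i) 0 + Num.max (flow i) 0.
    by rewrite addr_min_max addr0.
  have := split_flow j; have := split_flow (j - 1); rewrite /Y.
  move: (Num.min (flow j) 0) (Num.max (flow j) 0) => a b.
  move: (Num.min (flow (j - 1)) 0) (Num.max (flow (j - 1)) 0) => a' b' -> ->.
  ring.
apply: upwind_step_ge0; [exact/ltW/lam_gt0|exact: Y0|exact: Y0|].
have Yj := Y0 j mid.
have YE : Xmax m - X_ j = Y j by [].
(* By [bulk_diff], the bulk part of the divergence combines with the feed into a multiple of [Xmax]
   minus the total feed concentration, which is nonnegative; only the drift part has to be
   estimated. *)
have -> : lam * src =
    lam * ((j == jf m N)%:R * (Xmax m - \sum_k Cfn m dt n k) * Qfn m dt n)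
    + Xmax m * (lam * area_ j * drift j - lam * area_ (j - 1) * drift (j - 1))
    - dt * (gamma m (zcell m N j) * vsum (RC m (c j) (s j))).
  rewrite -lam_reaction -/react /src !flowE.
  rewrite /feed ![_ * Qfn _ _ _]mulrAC -(bulk_diff hm hN); ring.
have hfeed :
    0 <= lam * ((j == jf m N)%:R * (Xmax m - \sum_k Cfn m dt n k) * Qfn m dt n).
  apply: mulr_ge0 (ltW lam_gt0) (feed_ge0 hm dt_gt0 hT _ _).
  by rewrite subr_ge0 (sum_Cfn_le hm dt_gt0 hT).
have hreact : dt * (gamma m (zcell m N j) * vsum (RC m (c j) (s j))) <=
              dt * Num.max (MC m) (MCtot m) * Y j.
  rewrite -mulrA ler_pM2l//.
  have R1 := RCtot_upper hm (hOmega jN) kC_gt0.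
  have R2 := mulr_ge0 (MCtot_ge0 hm (hOmega jN) kC_gt0) Yj.
  have R3 : MCtot m * Y j <= Num.max (MC m) (MCtot m) * Y j.
    by rewrite ler_wpM2r// le_max lexx orbT.
  rewrite YE in R1.
  by case: (gamma_cases (m := m) (zcell m N j)) => ->; lra.
have /andP[/ltW M0 _] := adm_Xmax hm.
have dr := ler_wpM2l (lam_area_ge0 j) drift_r_ge.
have dl := ler_wpM2l (lam_area_ge0 (j - 1)) drift_l_le.
have l2 := ler_wpM2r (mulr_ge0 (sup_norm_ge0 M0 (adm_dvhs_bound hm)) Yj)
  lam_area_l.
have l3 := ler_wpM2r (mulr_ge0 (sup_norm_ge0 M0 (adm_dC_bound hm)) Yj)
  lam_area_sum.
have hdrift : - (q2 * (Lv * Y j) + q3 * (Ld * Y j)) <=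
    lam * area_ j * drift j - lam * area_ (j - 1) * drift (j - 1).
  rewrite YE in dr dl; lra.
(* Multiplied by [Xmax], the drift bound yields exactly the two Lipschitz terms of [beta1]. *)
have := ler_wpM2l M0 hdrift.
have := ler_wpM2r Yj outflow_le.
have := ler_wpM2r Yj cfl1E.
lra.
Qed.

(** * Soluble components: nonnegativity *)

Hypothesis hRS : RS_ge0 m.
Hypothesis kS_gt0 : (0 < kS)%N.
Hypothesis cfl2 : dt * beta2 m N T <= 1.

Definition liquid_flow i :=
  rhoX m * bulk_ i
  - (Num.min (flow i) 0 * X_ (i + 1) + Num.max (flow i) 0 * X_ i).

Lemma PhiSE k i : PhiS m N dt n c s k i =
  Num.min (liquid_flow i) 0 * (s (i + 1) 0 k / (rhoX m - X_ (i + 1)))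
  + Num.max (liquid_flow i) 0 * (s i 0 k / (rhoX m - X_ i))
  - area_ i * (diffS m k * ((s (i + 1) 0 k - s i 0 k) / h)).
Proof.
have <- : Ahalf m N i * (rhoX m * qhalf m N dt n i - FXhalf m N dt n c i)
        = liquid_flow i.
  rewrite mulrBr [in LHS]mulrCA /FXhalf; congr (_ - _).
  by rewrite mulrDr !mulrA Ahalf_min Ahalf_max.
rewrite /PhiS -Ahalf_min -Ahalf_max mulrBr mulrDr !mulrA.
by rewrite /inner_area [gamma _ _ * _]mulrC.
Qed.

(** Liquid moves forward with the bulk or in exchange for solids moving backward, whose
    concentration is at most [Xmax]; solids moving forward only reduce this flow. *)
Lemma liquid_max_le i : 0 <= X_ i <= Xmax m -> 0 <= X_ (i + 1) <= Xmax m ->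
  Num.max (liquid_flow i) 0 <=
  rhoX m * Num.max (bulk_ i) 0 - Xmax m * Num.min (flow i) 0.
Proof.
move=> /andP[X0 XM] /andP[Y0 YM].
have b1 : bulk_ i <= Num.max (bulk_ i) 0 by rewrite le_max lexx.
have b2 : 0 <= Num.max (bulk_ i) 0 by rewrite le_max lexx orbT.
have f1 : 0 <= - Num.min (flow i) 0 by rewrite oppr_ge0 ge_min lexx orbT.
have f2 : 0 <= Num.max (flow i) 0 by rewrite le_max lexx orbT.
have /andP[M0 MX] := adm_Xmax hm; have r0 := ltW (lt_trans M0 MX).
have g1 := ler_wpM2l r0 b1; have g2 := mulr_ge0 r0 b2.
have g3 := ler_wpM2r f1 YM; have g4 := mulr_ge0 f2 X0.
have g5 := mulr_ge0 (ltW M0) f1.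
by rewrite ge_max /liquid_flow; apply/andP; split; lra.
Qed.

Lemma liquid_min_le i : 0 <= X_ i <= Xmax m -> 0 <= X_ (i + 1) <= Xmax m ->
  - Num.min (liquid_flow i) 0 <=
  - (rhoX m * Num.min (bulk_ i) 0) + Xmax m * Num.max (flow i) 0.
Proof.
move=> /andP[X0 XM] /andP[Y0 YM].
have b1 : - bulk_ i <= - Num.min (bulk_ i) 0 by rewrite lerN2 ge_min lexx.
have b2 : 0 <= - Num.min (bulk_ i) 0 by rewrite oppr_ge0 ge_min lexx orbT.
have f1 : 0 <= - Num.min (flow i) 0 by rewrite oppr_ge0 ge_min lexx orbT.
have f2 : 0 <= Num.max (flow i) 0 by rewrite le_max lexx orbT.
have /andP[M0 MX] := adm_Xmax hm; have r0 := ltW (lt_trans M0 MX).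
have g1 := ler_wpM2l r0 b1; have g2 := mulr_ge0 r0 b2.
have g3 := ler_wpM2l f2 XM; have g4 := mulr_ge0 f1 Y0.
have g5 := mulr_ge0 (ltW M0) f2.
by rewrite lerNl le_min /liquid_flow; apply/andP; split; lra.
Qed.

(** The bulk outflow enters with weight [rhoX] and the solids inflow with weight [Xmax]. The bulk
    part of each is at most [Qfmax], whence the factor [rhoX + Xmax]; settling enters through the
    left interface only. *)
Lemma liquid_outflow_le :
  lam * (Num.max (liquid_flow j) 0 - Num.min (liquid_flow (j - 1)) 0) <=
  (rhoX m + Xmax m) * q1 + Xmax m * (q2 * vhs m 0 + q3 * Dmax).
Proof.
have /andP[/ltW M0 /ltW MX] := adm_Xmax hm; have r0 := le_trans M0 MX.
have w1 := liquid_max_le (X_near mid) (X_near rtj).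
have w2 := @liquid_min_le (j - 1) (X_near ltj).
rewrite subrK in w2; have {}w2 := w2 (X_near mid).
have f1 := flow_min_le (X_near mid) (X_near rtj).
have f2 := @flow_max_le (j - 1) (X_near ltj).
rewrite subrK in f2; have {}f2 := f2 (X_near mid).
have bo := ler_wpM2l r0 (bulk_outflow_le hm hN dt_gt0 hT j).
have bi := bulk_inflow_le hm hN dt_gt0 hT j.
have /(ler_wpM2l M0) fi : Num.max (flow (j - 1)) 0 - Num.min (flow j) 0 <=
    Qfmax m T + area_ (j - 1) * vhs m 0
    + (area_ j + area_ (j - 1)) * (Dmax / h) by lra.
have /(ler_wpM2l (ltW lam_gt0)) w :
    Num.max (liquid_flow j) 0 - Num.min (liquid_flow (j - 1)) 0 <=
    rhoX m * Qfmax m T + Xmax m * (Qfmax m T + area_ (j - 1) * vhs m 0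
    + (area_ j + area_ (j - 1)) * (Dmax / h)) by lra.
have l1 := ler_wpM2l (addr_ge0 r0 M0) lam_Qfmax.
have l2 := ler_wpM2l M0 (ler_wpM2r (vhs0_ge0 hm) lam_area_l).
have l3 := ler_wpM2l M0 (ler_wpM2r (DC_Xmax_ge0 hm) lam_area_sum).
lra.
Qed.

Lemma diffS_le_dmax k : diffS m k <= dmax m.
Proof. exact: le_bigmax. Qed.

Lemma cfl2E :
  ((rhoX m + Xmax m) * q1 + Xmax m * (q2 * vhs m 0 + q3 * Dmax))
    / (rhoX m - Xmax m)
  + dmax m * q3 + dt * MS m <= 1.
Proof.
have /andP[/ltW M0 MX] := adm_Xmax hm.
have r0 : 0 <= Xmax m / (rhoX m - Xmax m) by rewrite divr_ge0// subr_ge0 ltW.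
have v := ler_wpM2l r0 (ler_wpM2l q2_ge0 (vhs0_le_sup_norm hm)).
by apply: le_trans cfl2; rewrite /beta2; lra.
Qed.

Lemma nextS_ge0 k : 0 <= nextS m N dt n c s j k.
Proof.
rewrite /nextS !PhiSE subrK.
set fr := area_ j * _; set fl := area_ (j - 1) * _.
set feed := (j == jf m N)%:R * _ * _; set react := _ * RS _ _ _ _ _.
have /andP[/ltW M0 MX] := adm_Xmax hm.
have r0 : 0 < rhoX m - Xmax m by rewrite subr_gt0.
have rX i : j - 1 <= i <= j + 1 -> 0 < rhoX m - X_ i.
  by move=> /X_near/andP[_ XM]; lra.
have u0 := S_near k mid; have ur := S_near k rtj; have ul := S_near k ltj.
(* The diffusive fluxes are moved into the source, so that the transport part is purely upwind in
   [s / (rhoX - X)]. *)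
rewrite [X in _ + lam * X](_ : _ =
  - ((Num.min (liquid_flow j) 0 * (s (j + 1) 0 k / (rhoX m - X_ (j + 1)))
      + Num.max (liquid_flow j) 0 * (s j 0 k / (rhoX m - X_ j)))
     - (Num.min (liquid_flow (j - 1)) 0 * (s j 0 k / (rhoX m - X_ j))
        + Num.max (liquid_flow (j - 1)) 0
          * (s (j - 1) 0 k / (rhoX m - X_ (j - 1)))))
  + (fr - fl + feed + react)); last by ring.
apply: upwind_step_ge0; [exact/ltW/lam_gt0| | |].
- by rewrite divr_ge0// ltW// rX.
- by rewrite divr_ge0// ltW// rX.
have uX0 : 0 <= s j 0 k / (rhoX m - X_ j) by rewrite divr_ge0// ltW// rX.
have out := ler_wpM2r uX0 liquid_outflow_le.
pose K := (rhoX m + Xmax m) * q1 + Xmax m * (q2 * vhs m 0 + q3 * Dmax).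
have K0 : 0 <= K.
  have q10 : 0 <= q1 := le_trans (mulr_ge0 (ltW lam_gt0) Qfmax_ge0) lam_Qfmax.
  have q2v := mulr_ge0 q2_ge0 (vhs0_ge0 hm).
  have q3D := mulr_ge0 q3_ge0 (DC_Xmax_ge0 hm).
  apply: addr_ge0; last exact: mulr_ge0 M0 (addr_ge0 q2v q3D).
  by apply: mulr_ge0 q10; lra.
(* Replacing [X] by [Xmax] in the denominator produces the factor [1 / (rhoX - Xmax)] of [beta2]. *)
have uX : s j 0 k / (rhoX m - X_ j) <= s j 0 k / (rhoX m - Xmax m).
  rewrite ler_wpM2l// lef_pV2 ?posrE ?rX//.
  by have /andP[_ XM] := X_near mid; lra.
have out' := ler_wpM2l K0 uX.
have d0 := ltW (adm_diffS hm k).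
have dh0 : 0 <= diffS m k / h := divr_ge0 d0 (ltW h0).
have hr := mulr_ge0 (mulr_ge0 (lam_area_ge0 j) dh0) ur.
have hl := mulr_ge0 (mulr_ge0 (lam_area_ge0 (j - 1)) dh0) ul.
have l3 := ler_wpM2r (mulr_ge0 d0 u0) lam_area_sum.
have l3' := ler_wpM2r (mulr_ge0 q3_ge0 u0) (diffS_le_dmax k).
(* The neighbours contribute the nonnegative gains [hr] and [hl]; the loss is proportional to the
   sum of the two inner areas, hence controlled by [q3]. *)
have diffusion : - (dmax m * q3 * s j 0 k) <= lam * (fr - fl).
  by rewrite /fr /fl; lra.
have hfeed : 0 <= lam * feed.
  apply: mulr_ge0 (ltW lam_gt0) (feed_ge0 hm dt_gt0 hT _ _).
  exact: (Sfn_ge0 hm dt_gt0 hT).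
have hreact : - (dt * MS m * s j 0 k) <= lam * react.
  rewrite lam_reaction -mulrA -mulrN ler_pM2l//.
  have := RS_lower hm (hOmega jN) k hRS.
  have := mulr_ge0 (MS_ge0 hm (hOmega jN) kS_gt0) u0.
  by case: (gamma_cases (m := m) (zcell m N j)) => ->; lra.
have := ler_wpM2r u0 cfl2E; rewrite -/K.
rewrite -/K in out.
lra.
Qed.

End Invariance.

Theorem theorem1 (R : realType) (kC kS : nat) (hkC : (1 <= kC)%N)
  (hkS : (1 <= kS)%N) (m : model R kC kS) (T : R) (hm : admissible m T)
  (hRS : RS_ge0 m)
  (N : nat) (hN : (1 <= N)%N) (dt : R) (hdt : 0 < dt)
  (n : nat) (hT : n.+1%:R * dt <= T)
  (C : nat -> int -> 'rV[R]_kC) (S : nat -> int -> 'rV[R]_kS)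
  (houter : zero_outer N (C n) (S n))
  (hscheme : scheme_step m N dt n C S)
  (hOmega : forall j : int, in_grid N j -> Omega m (state m (C n j) (S n j)))
  (hCFL : dt * Num.max (beta1 m N T) (beta2 m N T) <= 1) :
  forall j : int, in_grid N j -> Omega m (state m (C n.+1 j) (S n.+1 j)).
Proof.
move=> j jN; have [nC nS] := hscheme _ jN.
have /andP[cfl1 cfl2] : (dt * beta1 m N T <= 1) && (dt * beta2 m N T <= 1).
  by rewrite -ge_max -maxr_pMr ?(ltW hdt).
apply: Omega_intro => [k||k].
- rewrite nC.
  exact: (nextC_ge0 hm hN hdt hT houter hOmega jN hkC cfl1).
- rewrite /vsum; under eq_bigr do rewrite nC.
  exact: (sum_nextC_le hm hN hdt hT houter hOmega jN hkC cfl1).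
- rewrite nS.
  exact: (nextS_ge0 hm hN hdt hT houter hOmega jN hRS hkS cfl2).
Qed.
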